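(* Let $H=\{(x,y)\in\{1,\dots,n\}^2: xy\le n\}$. Then there are absolute constants $C_1,C_2>0$ such that $C_1 n\le F(H)\le C_2\, n(\log n)^{1/2}$ for all $n\ge 2$, i.e. $F(H)=\Omega(n)$ and $F(H)=O(n(\log n)^{1/2})$.
   Context: Switching game on a board $H\subseteq\{1,\dots,n\}^2$: there is one switch for each row and each column meeting $H$. An initial configuration is $a_{ij}\in\{-1,+1\}$ for $(i,j)\in H$; a switch setting is $x_i,y_j\in\{-1,+1\}$. The signed discrepancy is $\sum_{(i,j)\in H}a_{ij}x_iy_j$ and the maximum discrepancy is $F(H)=\min_{(a_{ij})}\max_{(x_i),(y_j)}\sum_{(i,j)\in H}a_{ij}x_iy_j$. *)

(* Defs.v *)
From mathcomp Require Import all_boot all_order all_algebra.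
Set Implicit Arguments.
Unset Strict Implicit.
Unset Printing Implicit Defensive.
Import Order.TTheory GRing.Theory Num.Theory.
Local Open Scope ring_scope.

(* Boards are subsets of {1, ..., n}^2; the index i : 'I_n stands for the row
   or column numbered i.+1.  A sign in {-1, +1} is encoded by b : bool, with
   value (-1) ^+ b. *)
Definition board (n : nat) := {set 'I_n * 'I_n}.

(* Configurations and switch settings are total: the entries outside the board
   and the switches of rows and columns not meeting it do not occur in
   signed_discrepancy, hence affect neither the maximum nor the minimum. *)
Definition configuration (n : nat) := {ffun 'I_n * 'I_n -> bool}.
Definition switches (n : nat) := ({ffun 'I_n -> bool} * {ffun 'I_n -> bool})%type.

Definition signed_discrepancy (n : nat) (H : board n) (a : configuration n)
    (s : switches n) : int :=
  \sum_(p in H) (-1) ^+ a p * (-1) ^+ s.1 p.1 * (-1) ^+ s.2 p.2.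

(* In the next two definitions the bigop's default value is the value at a
   particular switch setting (resp. configuration), so that these are the exact
   maximum and minimum. *)
Definition best_discrepancy (n : nat) (H : board n) (a : configuration n) : int :=
  \big[Num.max/signed_discrepancy H a ([ffun=> false], [ffun=> false])]_(s : switches n)
    signed_discrepancy H a s.

Definition max_discrepancy (n : nat) (H : board n) : int :=
  \big[Num.min/best_discrepancy H [ffun=> false]]_(a : configuration n)
    best_discrepancy H a.

Definition hyperbolic_board (n : nat) : board n :=
  [set p : 'I_n * 'I_n | (p.1.+1 * p.2.+1 <= n)%N].

(* Main.v *)
(** Lower bound: column 1 of the board is full, so flipping its switch changes
    every row sum by 2; one of the two settings has total row norm at least n,
    and the row switches turn all row sums nonnegative.

    Upper bound: for fixed switches s, the product over p in H of
    1 + mu * (sign contributed by p) has average 1 over all configurations.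
    Hence some configuration makes the sum of these products over the 4^n
    switch settings at most 4^n.  As 1 + x >= exp (x - 2x^2) for x >= -1/2, each
    signed discrepancy S then satisfies mu S - 2 mu^2 |H| <= n ln 4.  With
    |H| <= n (1 + ln n), the choice mu = 1 / (4 sqrt (ln n)) gives the bound. *)
Require Import Defs.
From HB Require Import structures.
From mathcomp Require Import all_boot all_order all_algebra.
From mathcomp Require Import reals exp.
From mathcomp Require Import sequences ring lra.
Set Implicit Arguments.
Unset Strict Implicit.
Unset Printing Implicit Defensive.
Import Order.TTheory GRing.Theory Num.Theory.
Local Open Scope ring_scope.

Lemma signed_discrepancy_rows n (H : board n) (a : configuration n) x y :
  signed_discrepancy H a (x, y) =
  \sum_i (-1) ^+ x i * \sum_(j | (i, j) \in H) (-1) ^+ a (i, j) * (-1) ^+ y j.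
Proof.
under [RHS]eq_bigr do rewrite mulr_sumr.
by rewrite pair_big_dep; apply: eq_big => [[i j]|[i j] _] //=; ring.
Qed.

(** Setting each row switch to the sign of its row sum attains this total. *)
Lemma row_norms_le_best n (H : board n) (a : configuration n) (y : {ffun 'I_n -> bool}) :
  \sum_i `|\sum_(j | (i, j) \in H) (-1) ^+ a (i, j) * (-1) ^+ y j| <=
  best_discrepancy H a.
Proof.
set X := fun i => \sum_(j | (i, j) \in H) (-1) ^+ a (i, j) * (-1) ^+ y j : int.
suff -> : \sum_i `|X i| = signed_discrepancy H a ([ffun i => X i < 0], y).
  exact: le_bigmax.
rewrite signed_discrepancy_rows; apply: eq_bigr => i _.
by rewrite ffunE normrEsign.
Qed.

Lemma best_discrepancy_full_column n (H : board n) (a : configuration n) (c : 'I_n) :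
  (forall i, (i, c) \in H) -> n%:Z <= best_discrepancy H a.
Proof.
move=> Hc.
have B0 := row_norms_le_best H a [ffun => false].
have B1 := row_norms_le_best H a [ffun j => j == c].
suff: n%:Z *+ 2 <= best_discrepancy H a *+ 2 by rewrite ler_pMn2r.
rewrite [leRHS]mulr2n; apply: le_trans (lerD B0 B1); rewrite -big_split /=.
have -> : n%:Z *+ 2 = \sum_(i < n) 2 by rewrite sumr_const card_ord -natz mulrnAC.
(* The two sums of a row differ only in column [c], by 2 in absolute value, and |u - v| <= |u| +
   |v|. *)
apply: ler_sum => i _; apply: le_trans (ler_normB _ _).
rewrite -sumrB (bigD1 c) //= !ffunE eqxx big1 ?addr0 => [|j /andP[_ jc]].
  by case: (a _).
by rewrite !ffunE (negbTE jc) subrr.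
Qed.

Lemma max_discrepancy_full_column n (H : board n) (c : 'I_n) :
  (forall i, (i, c) \in H) -> n%:Z <= max_discrepancy H.
Proof.
by move=> Hc; apply: le_bigmin => [|a _]; apply: best_discrepancy_full_column Hc.
Qed.

Lemma exists_le_average (R : realFieldType) (T : finType) (F : T -> R) (c : R) :
  T -> \sum_t F t = #|T|%:R * c -> exists t, F t <= c.
Proof.
move=> t0 EF; apply/existsP; apply: contraT; rewrite negb_exists => /forallP h.
suff : #|T|%:R * c < \sum_t F t by rewrite EF ltxx.
rewrite mulr_natl -sumr_const; apply: ltr_sum => [|t _].
  by apply/hasP; exists t0; rewrite ?mem_index_enum.
by rewrite ltNge h.
Qed.

Section Riesz.
Variable R : realType.

(** Since exp (2x^2 - x) >= 1 - x + 2x^2, it suffices that (1 + x)(1 - x + 2x^2) = 1 + x^2 (1 + 2x)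
    is at least 1. *)
Lemma expR_le1Dx (x : R) : - 2^-1 <= x -> expR (x - 2 * x ^+ 2) <= 1 + x.
Proof.
move=> hx; have h := expR_ge1Dx (2 * x ^+ 2 - x).
have -> : x - 2 * x ^+ 2 = - (2 * x ^+ 2 - x) by ring.
rewrite expRN -[leLHS]mul1r ler_pdivrMr ?expR_gt0 //.
apply: le_trans (ler_wpM2l _ h); last lra.
have : 0 <= x ^+ 2 * (1 + 2 * x) by apply: mulr_ge0; [exact: sqr_ge0|lra].
lra.
Qed.

Definition riesz n (H : board n) (mu : R) (a : configuration n) (s : switches n) : R :=
  \prod_(p in H) (1 + mu * ((-1) ^+ a p * (-1) ^+ s.1 p.1 * (-1) ^+ s.2 p.2)).

Lemma sum_riesz n (H : board n) (mu : R) (s : switches n) :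
  \sum_a riesz H mu a s = #|configuration n|%:R.
Proof.
pose e (p : 'I_n * 'I_n) : R := (-1) ^+ s.1 p.1 * (-1) ^+ s.2 p.2.
(* The value 1 off the board lets the product run over all cells, as configurations do; at every
   cell the two values of [F] then add up to 2. *)
pose F p (b : bool) : R := if p \in H then 1 + mu * ((-1) ^+ b * e p) else 1.
transitivity (\sum_(a : configuration n) \prod_p F p (a p)).
  by apply: eq_bigr => a _; rewrite [LHS]big_mkcond; apply: eq_bigr => p _;
    rewrite /F /e mulrA.
rewrite -bigA_distr_bigA (eq_bigr (fun=> 2)); last first.
  by move=> p _; rewrite big_bool /F; case: ifP => _ /=; ring.
by rewrite prodr_const card_ffun card_bool natrX.
Qed.

(** The exponential bound applies to each factor at x = mu or x = -mu; as x^2 = mu^2 in both cases,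
    the quadratic losses add up to 2 mu^2 |H|. *)
Lemma riesz_ge n (H : board n) (mu : R) (a : configuration n) (s : switches n) : 0 <= mu <= 2^-1 ->
  expR (mu * (signed_discrepancy H a s)%:~R - 2 * mu ^+ 2 * #|H|%:R)
    <= riesz H mu a s.
Proof.
move=> /andP[mu0 mu2].
rewrite rmorph_sum /= mulr_sumr mulr_natr -sumr_const -sumrB expR_sum.
apply: ler_prod => p _; rewrite expR_ge0 /= !rmorphM /= !rmorph_sign.
set e := _ * _ * _.
have [->|->] : e = 1 \/ e = -1.
  by rewrite /e; case: (a p); case: (s.1 _); case: (s.2 _);
    rewrite /= ?expr0 ?expr1; [right|left|left|right|left|right|right|left]; ring.
- by rewrite mulr1 expR_le1Dx //; lra.
- by rewrite mulrN1 -[in leLHS]sqrrN expR_le1Dx //; lra.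
Qed.

Lemma exists_configuration n (H : board n) (mu : R) : 0 <= mu <= 2^-1 ->
  exists a, forall s, mu * (signed_discrepancy H a s)%:~R <=
    3 * n%:R + 2 * mu ^+ 2 * #|H|%:R.
Proof.
move=> hmu.
have [a ha] : exists a, \sum_s riesz H mu a s <= #|{: switches n}|%:R.
  apply: exists_le_average; first exact: [ffun => false].
  rewrite exchange_big (eq_bigr _ (fun s _ => sum_riesz H mu s)).
  by rewrite sumr_const mulr_natr.
exists a => s; rewrite -lerBlDr -ler_expR.
apply: le_trans (riesz_ge H a s hmu) _.
have r0 t : 0 <= riesz H mu a t.
  exact: le_trans (expR_ge0 _) (riesz_ge H a t hmu).
apply: le_trans (_ : _ <= #|{: switches n}|%:R) _.
  by apply: le_trans ha; rewrite (bigD1 s) //= lerDl sumr_ge0.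
(* There are 4^n switch settings, and 4 = 1 + 3 <= exp 3; hence the constant 3 instead of ln 4. *)
rewrite card_prod card_ffun card_bool card_ord -expnMn natrX expRM_natr.
rewrite lerXn2r ?nnegrE ?expR_ge0 //.
by apply: le_trans (expR_ge1Dx 3); rewrite -natr1; lra.
Qed.

Lemma best_discrepancy_le n (H : board n) (a : configuration n) (c : R) :
  (forall s, (signed_discrepancy H a s)%:~R <= c) ->
  (best_discrepancy H a)%:~R <= c.
Proof.
move=> h; rewrite /best_discrepancy; elim/big_ind: _ => // x y hx hy.
by rewrite maxEle; case: ifP.
Qed.

Lemma max_discrepancy_le n (H : board n) (mu : R) : 0 < mu <= 2^-1 ->
  (max_discrepancy H)%:~R <= 3 * n%:R / mu + 2 * mu * #|H|%:R.
Proof.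
move=> /andP[mu0 mu2].
have [|a ha] := @exists_configuration n H mu; first by rewrite ltW.
apply: le_trans (_ : _ <= (best_discrepancy H a)%:~R) _.
  by rewrite ler_int; apply: bigmin_le.
apply: best_discrepancy_le => s; rewrite -(ler_pM2l mu0).
have -> // : mu * (3 * n%:R / mu + 2 * mu * #|H|%:R) =
  3 * n%:R + 2 * mu ^+ 2 * #|H|%:R by field; lra.
Qed.

Lemma harmonic_le_ln n : \sum_(i < n.+1) (i.+1%:R : R)^-1 <= 1 + ln n.+1%:R.
Proof.
elim: n => [|n IH]; first by rewrite big_ord1 ln1 invr1 addr0.
rewrite big_ord_recr /=.
suff : n.+2%:R^-1 <= ln n.+2%:R - ln n.+1%:R :> R.
  by move=> h; apply: le_trans (lerD IH h) _; rewrite -addrA lerD2l addrC addrNK.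
(* With x = -1/(n+2), ln (1 + x) <= x reads ln ((n+1)/(n+2)) <= -1/(n+2). *)
have := @le_ln1Dx R (- n.+2%:R^-1).
have n2 : 0 < n.+2%:R :> R by [].
have -> : 1 + - n.+2%:R^-1 = n.+1%:R / n.+2%:R :> R.
  by rewrite -[n.+1%:R](addrK 1) natr1 mulrBl divff ?mul1r // gt_eqF.
rewrite ln_div ?posrE //.
suff : -1 < - n.+2%:R^-1 :> R by move=> lt1 /(_ lt1); rewrite lerNr opprB.
by rewrite ltrN2 invf_lt1 // ltr1n.
Qed.

Lemma card_hyperbolic_row n (i : 'I_n) :
  (#|[pred j : 'I_n | i.+1 * j.+1 <= n]| <= n %/ i.+1)%N.
Proof.
rewrite -sum1_card (eq_bigl (fun j : 'I_n => j < n %/ i.+1)%N); last first.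
  by move=> j; rewrite inE leq_divRL // mulnC.
by rewrite -(big_ord_widen _ (fun=> 1%N)) ?leq_div // sum1_card card_ord.
Qed.

(** Row i has at most n/i cells, so the count is at most n times the harmonic sum. *)
Lemma card_hyperbolic_board n :
  #|hyperbolic_board n|%:R <= n%:R * (1 + ln n%:R) :> R.
Proof.
case: n => [|n].
  by rewrite mul0r lern0 -leqn0 (leq_trans (max_card _)) ?card_prod ?card_ord.
apply: le_trans (ler_wpM2l _ (harmonic_le_ln n)) => //.
have -> : #|hyperbolic_board n.+1| =
    (\sum_(i < n.+1) #|[pred j : 'I_n.+1 | i.+1 * j.+1 <= n.+1]|)%N.
  under [RHS]eq_bigr do rewrite -sum1_card.
  by rewrite pair_big_dep -sum1_card; apply: eq_bigl => p; rewrite !inE.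
rewrite natr_sum mulr_sumr; apply: ler_sum => i _.
rewrite ler_pdivlMr // -natrM ler_nat.
by apply: leq_trans (leq_divM n.+1 i.+1); rewrite leq_mul2r card_hyperbolic_row orbT.
Qed.

End Riesz.

Theorem theorem9 (R : realType) :
  exists C1 C2 : R,
    [/\ 0 < C1, 0 < C2
      & forall n : nat, (2 <= n)%N ->
          C1 * n%:R <= (max_discrepancy (hyperbolic_board n))%:~R :> R /\
          (max_discrepancy (hyperbolic_board n))%:~R
            <= C2 * (n%:R * Num.sqrt (ln n%:R)) :> R].
Proof.
(* With w = sqrt (ln n) and mu = 1/(4w), 14 = 12 + 2: the term 3n/mu equals 12nw, and the term in
   |H| is at most 2nw. *)
exists 1, 14; split=> // n n2; split.
  rewrite mul1r -[n%:R]/(n%:Z%:~R) ler_int.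
  have n0 : (0 < n)%N by apply: leq_trans n2.
  apply: (@max_discrepancy_full_column n _ (Ordinal n0)) => i.
  by rewrite inE /= muln1.
set w := Num.sqrt _.
(* This bound gives w >= 1/2, hence mu <= 1/2, and also 1 + w^2 <= 4w^2. It follows from exp (-1/2)
   >= 1/2. *)
have ln2 : 2^-1 <= ln n%:R :> R.
  rewrite -ler_expR lnK ?posrE ?ltr0n; last exact: leq_trans n2.
  apply: le_trans (_ : 2 <= _); last by rewrite ler_nat.
  rewrite -[2^-1]opprK expRN -[leRHS]invrK lef_pV2 ?posrE ?expR_gt0 ?invr_gt0 //.
  by have := expR_ge1Dx (- 2^-1 : R); lra.
have w2 : w ^+ 2 = ln n%:R by rewrite sqr_sqrtr //; lra.
have w0 : 0 <= w by apply: sqrtr_ge0.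
have wh : 2^-1 <= w by nra.
have := card_hyperbolic_board R n; rewrite -w2 => hH.
have := @max_discrepancy_le R n (hyperbolic_board n) (4 * w)^-1.
have w4 : 0 < 4 * w by lra.
rewrite invr_gt0 w4 lef_pV2 ?posrE //= (_ : 2 <= 4 * w); last lra.
move=> /(_ isT) /le_trans; apply; rewrite invrK.
have Hle : 2 * (4 * w)^-1 * #|hyperbolic_board n|%:R <= 2 * (n%:R * w) :> R.
  rewrite mulrAC ler_pdivrMr //; have n0 : 0 <= n%:R :> R by [].
  rewrite -w2 in ln2.
  have : n%:R * (1 + w ^+ 2) <= n%:R * (4 * w ^+ 2) :> R by apply: ler_wpM2l; lra.
  nra.
lra.
Qed.
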